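(* Let $\mathcal{C}\subseteq\mathbb{F}(\!(D)\!)^n$ be an $(n,k,\delta)$-code such that both $k$ and $n-k$ divide $\delta$. Then $\mathcal{C}$ is strongly MDS if and only if the dual code $\mathcal{C}^\perp\subseteq\mathbb{F}(\!(D)\!)^n$ is strongly MDS.
   Context: Let $\mathbb{F}$ be a finite field, $\mathbb{F}[D]$ the polynomial ring and $\mathbb{F}(\!(D)\!)$ the field of formal Laurent series $\sum_{j\ge l}a_jD^j$. For $1\le k<n$, a convolutional code of rate $k/n$ is a set $\mathcal{C}=\{uG\mid u\in\mathbb{F}(\!(D)\!)^k\}\subseteq\mathbb{F}(\!(D)\!)^n$ with $G\in\mathbb{F}[D]^{k\times n}$ of rank $k$; $G$ is called a generator matrix of $\mathcal{C}$. A polynomial matrix is basic if it has a polynomial right inverse; a polynomial generator matrix is minimal if the sum of its row degrees is minimal among all polynomial generator matrices of $\mathcal{C}$. Every code has a generator matrix that is both minimal and basic, and the degree $\delta$ of $\mathcal{C}$ is the sum of the row degrees of such a matrix. A code of rate $k/n$ and degree $\delta$ is called an $(n,k,\delta)$-code. The dual code is $\mathcal{C}^\perp=\{w\in\mathbb{F}(\!(D)\!)^n\mid wv^{\mathsf T}=0\text{ for all }v\in\mathcal{C}\}$; it is an $(n,n-k,\delta)$-code. For $w\in\mathbb{F}^N$, $\mathrm{wt}(w)$ is the number of nonzero coordinates. For $v=\sum_j v_jD^j\in\mathbb{F}(\!(D)\!)^n\setminus\{0\}$ the delay of $v$ is $\min\{j\mid v_j\ne0\}$, and $v_{[m,M]}:=(v_m,\dots,v_M)$.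 For $j\ge 0$ the $j$th column distance of a code $\mathcal{C}$ is $d^c_j:=\min\{\mathrm{wt}(v_{[0,j]})\mid v\in\mathcal{C},\ \text{delay of }v\text{ equals }0\}$. An $(n,k,\delta)$-code is strongly MDS if $d^c_M=(n-k)\left(\lfloor\frac{\delta}{k}\rfloor+1\right)+\delta+1$ for $M=\lfloor\frac{\delta}{k}\rfloor+\lceil\frac{\delta}{n-k}\rceil$. (For the dual code the roles of $k$ and $n-k$ are interchanged.) *)

(* Defs.v *)
From HB Require Import structures.
From mathcomp Require Import all_boot all_order all_algebra.
From mathcomp Require Import zify.
From mathcomp Require Import all_classical.

Set Implicit Arguments.
Unset Strict Implicit.
Unset Printing Implicit Defensive.

Import Order.TTheory GRing.Theory Num.Theory.
Local Open Scope classical_set_scope.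
Local Open Scope ring_scope.

Definition lbounded (F : fieldType) (a : int -> F) (l : int) : Prop :=
  forall j, j < l -> a j = 0.

(* The series \sum_j a_j D^j is encoded by j |-> a_j, zero below some index. *)
Record laurent (F : fieldType) := Laurent {
  lcoef :> int -> F;
  lcoefP : exists l, lbounded lcoef l
}.

Notation "{ 'laurent' F }" := (laurent F) (format "{ 'laurent'  F }").

Section LaurentField.
Variable F : fieldType.
Implicit Types (a b c : {laurent F}) (f g h : int -> F) (l m : int).

HB.instance Definition _ := gen_eqMixin {laurent F}.
HB.instance Definition _ := gen_choiceMixin {laurent F}.

Lemma laurentP a b : (forall j, a j = b j) -> a = b.
Proof.
case: a b => [f hf] [g hg] /= /funext fg.
by case: _ / fg hg => hg; congr Laurent; exact: Prop_irrelevance.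
Qed.

Lemma lboundedW f l m : m <= l -> lbounded f l -> lbounded f m.
Proof. by move=> ml fl j jm; apply: fl; exact: lt_le_trans ml. Qed.

Lemma lbounded2 a b : exists l, lbounded a l /\ lbounded b l.
Proof.
have [la ha] := lcoefP a; have [lb hb] := lcoefP b.
exists (Num.min la lb); split.
  by apply: lboundedW ha; rewrite ge_min lexx.
by apply: lboundedW hb; rewrite ge_min lexx orbT.
Qed.

Lemma lzero_subproof : exists l, lbounded (fun _ : int => 0 : F) l.
Proof. by exists 0. Qed.
Definition lzero := Laurent lzero_subproof.

Lemma lone_subproof : exists l, lbounded (fun j : int => (j == 0)%:R : F) l.
Proof. by exists 0 => j; case: eqP => // ->; rewrite ltxx. Qed.
Definition lone := Laurent lone_subproof.

Lemma lopp_subproof a : exists l, lbounded (fun j => - a j) l.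
Proof. by have [l h] := lcoefP a; exists l => j /h ->; rewrite oppr0. Qed.
Definition lopp a := Laurent (lopp_subproof a).

Lemma ladd_subproof a b : exists l, lbounded (fun j => a j + b j) l.
Proof.
have [l [ha hb]] := lbounded2 a b.
by exists l => j jl; rewrite ha // hb // addr0.
Qed.
Definition ladd a b := Laurent (ladd_subproof a b).

(* All but finitely many terms of the sum vanish, as f and g are bounded below. *)
Definition conv f g (m : int) : F := \sum_(i \in [set: int]) f i * g (m - i).

Definition ltrunc f l (N : nat) : {poly F} := \poly_(i < N) f (l + i%:Z).

Lemma convE f g l m (N k : nat) : lbounded f l -> lbounded g m -> (k < N)%N ->
  conv f g (l + m + k%:Z) = (ltrunc f l N * ltrunc g m N)`_k.
Proof.
move=> hf hg kN; rewrite /conv.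
rewrite (fsbigE [seq l + i%:Z | i <- iota 0 k.+1]) //; first 1 last.
- by rewrite map_inj_uniq ?iota_uniq // => i j /addrI [].
- move=> i _ /negP ni.
  have [il|li] := ltP i l; first by rewrite hf ?mul0r.
  have [ik|ki] := ltP (l + k%:Z) i; first by rewrite hg ?mulr0 //; lia.
  case: ni; apply/mapP; exists `|i - l|%N; last lia.
  by rewrite mem_iota; lia.
rewrite (eq_bigl xpredT) => [|i]; last by rewrite in_setT.
rewrite big_map -/(index_iota 0 k.+1) big_mkord coefM.
apply: eq_bigr => i _; rewrite !coef_poly.
have ik := ltn_ord i; rewrite !ifT; [|lia|lia].
by congr (_ * g _); lia.
Qed.

Lemma conv_bounded f g l m : lbounded f l -> lbounded g m ->
  lbounded (conv f g) (l + m).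
Proof.
move=> hf hg j jlm; rewrite /conv fsbig1 // => i _.
have [il|li] := ltP i l; first by rewrite hf ?mul0r.
by rewrite hg ?mulr0 //; lia.
Qed.

Lemma lmul_subproof a b : exists l, lbounded (conv a b) l.
Proof.
have [l [ha hb]] := lbounded2 a b.
by exists (l + l); exact: conv_bounded.
Qed.
Definition lmul a b := Laurent (lmul_subproof a b).

Lemma lbounded_eq a b l : lbounded a l -> lbounded b l ->
  (forall k : nat, a (l + k%:Z) = b (l + k%:Z)) -> a = b.
Proof.
move=> ha hb ab; apply: laurentP => j.
have [jl|lj] := ltP j l; first by rewrite ha // hb.
by have -> : j = l + `|j - l|%N%:Z by lia.
Qed.

Lemma coefM_trunc (p p' q : {poly F}) (k : nat) :
  (forall i, (i <= k)%N -> p`_i = p'`_i) -> (p * q)`_k = (p' * q)`_k.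
Proof.
by move=> pp'; rewrite !coefM; apply: eq_bigr => i _; rewrite pp' // -ltnS.
Qed.

Lemma laddA : associative ladd.
Proof. by move=> a b c; apply: laurentP => j /=; rewrite addrA. Qed.
Lemma laddC : commutative ladd.
Proof. by move=> a b; apply: laurentP => j /=; rewrite addrC. Qed.
Lemma ladd0 : left_id lzero ladd.
Proof. by move=> a; apply: laurentP => j /=; rewrite add0r. Qed.
Lemma laddN : left_inverse lzero lopp ladd.
Proof. by move=> a; apply: laurentP => j /=; rewrite addNr. Qed.

Lemma lmulC : commutative lmul.
Proof.
move=> a b; have [l [ha hb]] := lbounded2 a b.
apply: (@lbounded_eq _ _ (l + l)) => [||k]; try exact: conv_bounded.
by rewrite /= !(@convE _ _ _ _ k.+1) // mulrC.
Qed.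

Lemma lmulA : associative lmul.
Proof.
move=> a b c; have [la ha] := lcoefP a.
have [lb hb] := lcoefP b; have [lc hc] := lcoefP c.
have hab := conv_bounded ha hb; have hbc := conv_bounded hb hc.
apply: (@lbounded_eq _ _ (la + lb + lc)) => [||k].
- by rewrite -addrA; exact: conv_bounded.
- exact: conv_bounded.
rewrite /= [RHS](@convE _ _ _ _ k.+1) // -[X in conv a _ (X + _)]addrA.
rewrite (@convE _ _ _ _ k.+1) // mulrC.
transitivity (ltrunc b lb k.+1 * ltrunc c lc k.+1 * ltrunc a la k.+1)`_k.
  apply: coefM_trunc => i ik; rewrite coef_poly ltnS ik.
  by rewrite (@convE _ _ _ _ k.+1).
rewrite mulrC mulrA; apply/esym/coefM_trunc => i ik.
by rewrite coef_poly ltnS ik (@convE _ _ _ _ k.+1).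
Qed.

Lemma lmulDl : left_distributive lmul ladd.
Proof.
move=> a b c; have [l [ha hb]] := lbounded2 a b; have [m hc] := lcoefP c.
have hab : lbounded (ladd a b) l by move=> j jl /=; rewrite ha // hb // addr0.
apply: (@lbounded_eq _ _ (l + m)) => [||k]; first exact: conv_bounded.
  by move=> j jl /=; rewrite !(@conv_bounded _ _ l m) // addr0.
rewrite /= -[fun j => _]/(lcoef (ladd a b)) !(@convE _ _ _ _ k.+1) //.
rewrite -coefD -mulrDl; congr ((_ * ltrunc c m k.+1 : {poly F})`_k); apply/polyP => i.
by rewrite coefD !coef_poly; case: ifP => _; rewrite ?addr0.
Qed.

Lemma lmul1 : left_id lone lmul.
Proof.
move=> a; have [l ha] := lcoefP a.
have h1 : lbounded lone 0 by move=> j /=; case: eqP => // ->; rewrite ltxx.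
apply: (@lbounded_eq _ _ l) => [||k] //.
  by rewrite -[l]add0r; exact: conv_bounded.
rewrite -[X in _ (X + _)]add0r /= (@convE _ _ _ _ k.+1) //.
have -> : ltrunc (fun j : int => (j == 0)%:R) 0 k.+1 = 1.
  apply/polyP => i; rewrite coef_poly coef1 add0r.
  by case: i => [|i] //=; case: ifP.
by rewrite mul1r coef_poly ltnSn.
Qed.

Lemma lone_neq0 : lone != lzero.
Proof.
apply/eqP => /(congr1 (fun a : {laurent F} => a 0)) /= /eqP.
by rewrite oner_eq0.
Qed.

HB.instance Definition _ := GRing.isZmodule.Build {laurent F}
  laddA laddC ladd0 laddN.
HB.instance Definition _ := GRing.Zmodule_isComNzRing.Build {laurent F}
  lmulA lmulC lmul1 lmulDl lone_neq0.

Definition linv a : {laurent F} := xget 0 [set b | b * a = 1].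

Lemma laurent_lead a : a != 0 -> exists l, lbounded a l /\ a l != 0.
Proof.
move=> a0; have [l ha] := lcoefP a.
have exn : exists n : nat, a (l + n%:Z) != 0.
  apply: contrapT => /forallNP an; case/eqP: a0.
  apply: (lbounded_eq ha) => // k.
  by apply/eqP; apply: contrapT => /negP; exact: an.
exists (l + (ex_minn exn)%:Z); case: ex_minnP => n an nmin; split => // j jn.
have [jl|lj] := ltP j l; first exact: ha.
apply/eqP; apply: contrapT => /negP aj.
have := nmin `|j - l|%N; have -> : l + `|j - l|%N%:Z = j by lia.
by move=> /(_ aj); lia.
Qed.

Fixpoint linv_seq f (n : nat) : seq F :=
  if n is n'.+1 then
    let s := linv_seq f n' in
    rcons s (((n' == 0)%N%:R - \sum_(i < n') s`_i * f (n' - i)%N%:Z) / f 0)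
  else [::].

Lemma size_linv_seq f n : size (linv_seq f n) = n.
Proof. by elim: n => //= n IHn; rewrite size_rcons IHn. Qed.

Lemma nth_linv_seq f n i : (i < n)%N ->
  (linv_seq f n)`_i = (linv_seq f i.+1)`_i.
Proof.
elim: n => // n IHn; rewrite ltnS leq_eqVlt => /orP[/eqP -> //|lt_in].
by rewrite [LHS]/= nth_rcons size_linv_seq lt_in IHn.
Qed.

Lemma linv_ex a : a != 0 -> exists b, b * a = 1.
Proof.
move=> /laurent_lead [l [ha al]].
pose f j := a (l + j).
pose c (j : int) : F :=
  if j is Posz n then (linv_seq f n.+1)`_n else 0.
have hc : exists m, lbounded (fun j => c (j + l)) m.
  by exists (- l) => j jl; rewrite /c; case E: (j + l) => [n|] //; lia.
exists (Laurent hc).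
have hb : lbounded (Laurent hc) (- l).
  by move=> j jl /=; rewrite /c; case E: (j + l) => [n|] //; lia.
have h0 : lbounded (1 : {laurent F}) 0.
  by move=> j /=; case: eqP => // ->; rewrite ltxx.
apply: (@lbounded_eq _ _ (- l + l)) => [||k].
- exact: conv_bounded.
- by rewrite addNr.
rewrite /= (@convE _ _ _ _ k.+1) // addNr add0r coefM.
rewrite big_ord_recr /= subnn.
have -> : \sum_(i < k) (ltrunc (fun j => c (j + l)) (- l) k.+1)`_i *
    (ltrunc a l k.+1)`_(k - i)
    = \sum_(i < k) (linv_seq f k)`_i * f (k - i)%N%:Z.
  apply: eq_bigr => i _; have ik := ltn_ord i; rewrite !coef_poly !ifT; [|lia|lia].
  by rewrite addrAC addNr add0r /= -/(linv_seq f i.+1) -(nth_linv_seq f ik).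
rewrite !coef_poly ltnSn /= addrAC addNr add0r addr0 /=.
rewrite nth_rcons size_linv_seq ltnn eqxx /f addr0 mulfVK //.
by rewrite addrC subrK.
Qed.

Lemma lmulVf a : a != 0 -> linv a * a = 1.
Proof.
move=> /linv_ex [b ba1].
exact: (@xgetPex _ 0 [set b | b * a = 1] (ex_intro _ b ba1)).
Qed.

Lemma linv0 : linv 0 = 0.
Proof.
rewrite /linv; case: xgetP => // b _ /= /esym/eqP.
by rewrite mulr0 oner_eq0.
Qed.

HB.instance Definition _ := GRing.ComNzRing_isField.Build {laurent F}
  lmulVf linv0.

Lemma laurent_of_poly_subproof (p : {poly F}) :
  exists l, lbounded (fun j : int => if j is Posz i then p`_i else 0) l.
Proof. by exists 0 => -[]. Qed.
Definition laurent_of_poly (p : {poly F}) : {laurent F} :=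
  Laurent (laurent_of_poly_subproof p).

Lemma laurent_of_poly_is_zmod_morphism : zmod_morphism laurent_of_poly.
Proof.
by move=> p q; apply: laurentP => -[j|j] /=; rewrite ?coefB ?subr0.
Qed.

Lemma laurent_of_poly_is_monoid_morphism : monoid_morphism laurent_of_poly.
Proof.
split=> [|p q]; first by apply: laurentP => -[j|j] /=; rewrite ?coef1.
have hp r : lbounded (laurent_of_poly r) 0 by case.
apply: (@lbounded_eq _ _ 0) => [||k] //.
  by rewrite -[0]addr0; exact: conv_bounded.
have hr (r : {poly F}) i : (i <= k)%N ->
    r`_i = (ltrunc (laurent_of_poly r) 0 k.+1)`_i.
  by rewrite coef_poly add0r ltnS => ->.
rewrite -{2}[0]addr0 [RHS](convE (hp p) (hp q) (ltnSn k)) /=.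
rewrite (coefM_trunc _ (hr p)) mulrC (coefM_trunc _ (hr q)).
by rewrite mulrC.
Qed.

HB.instance Definition _ := GRing.isZmodMorphism.Build {poly F} {laurent F}
  laurent_of_poly laurent_of_poly_is_zmod_morphism.
HB.instance Definition _ := GRing.isMonoidMorphism.Build {poly F} {laurent F}
  laurent_of_poly laurent_of_poly_is_monoid_morphism.

End LaurentField.

Definition is_min (d : Order.disp_t) (T : porderType d) (A : set T) (m : T) :
    Prop :=
  A m /\ lbound A m.

Section ConvolutionalCodes.
Variables (F : finFieldType) (n : nat).
Implicit Types (k : nat) (C : set 'rV[{laurent F}]_n).

(* The rank is taken over F((D)), which contains F[D]. *)
Definition generator_matrix k C (G : 'M[{poly F}]_(k, n)) : Prop :=
  let GD := map_mx (@laurent_of_poly F) G in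
  \rank GD = k /\ C = [set u *m GD | u in [set: 'rV[{laurent F}]_k]].

Definition basic k (G : 'M[{poly F}]_(k, n)) : Prop :=
  exists X : 'M[{poly F}]_(n, k), G *m X = 1%:M.

(* A zero row would get degree 0, but a generator matrix has none. *)
Definition row_degree k (G : 'M[{poly F}]_(k, n)) (i : 'I_k) : nat :=
  (\max_(j < n) (size (G i j)).-1)%N.

Definition sum_row_degrees k (G : 'M[{poly F}]_(k, n)) : nat :=
  (\sum_(i < k) row_degree G i)%N.

Definition minimal k C (G : 'M[{poly F}]_(k, n)) : Prop :=
  generator_matrix C G /\
  forall G' : 'M[{poly F}]_(k, n),
    generator_matrix C G' -> (sum_row_degrees G <= sum_row_degrees G')%N.

(* C is an (n, k, delta)-code. *)
Definition is_code k (delta : nat) C : Prop :=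
  (0 < k < n)%N /\
  exists G : 'M[{poly F}]_(k, n),
    [/\ minimal C G, basic G & sum_row_degrees G = delta].

Definition dual C : set 'rV[{laurent F}]_n :=
  [set w | forall v, C v -> w *m v^T = 0].

Definition wt (N : nat) (w : 'rV[F]_N) : nat := #|[set i | w 0 i != 0]|.

Definition coef_vec (v : 'rV[{laurent F}]_n) (j : int) : 'rV[F]_n :=
  map_mx (fun a : {laurent F} => a j) v.

Definition is_delay (v : 'rV[{laurent F}]_n) (d : int) : Prop :=
  is_min [set j | coef_vec v j != 0] d.

(* v_[0,j] = (v_0, ..., v_j), as a vector of length (j + 1) n. *)
Definition window0 (j : nat) (v : 'rV[{laurent F}]_n) : 'rV[F]_(j.+1 * n) :=
  mxvec (\matrix_(i < j.+1) coef_vec v i%:Z).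

(* d is the j-th column distance of C. *)
Definition is_column_distance (j : nat) C (d : nat) : Prop :=
  is_min [set wt (window0 j v) | v in [set v | C v /\ is_delay v 0]] d.

Definition ceil_divn (a b : nat) : nat := (a %/ b + ~~ (b %| a))%N.

(* Only meant for an (n, k, delta)-code C: k and delta are then determined by
   C, and are passed explicitly because they occur in the formula. *)
Definition strongly_MDS k (delta : nat) C : Prop :=
  is_column_distance (delta %/ k + ceil_divn delta (n - k))%N C
    ((n - k) * (delta %/ k + 1) + delta + 1)%N.

End ConvolutionalCodes.

(* Main.v *)
(* Write C = {u G} with G X = 1, so that the dual code is {w | w G^T = 0}.  For a
   in {k, n - k} the M-th column distance of the corresponding code is at most
   (n - a)(M + 1) + 1, and when k and n - k divide delta the strongly MDS property
   says, for the same M on both sides, that this bound is attained, i.e. that no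
   causal word with nonzero constant term has weight at most (n - a)(M + 1) on
   [0, M] (call such a word short).

   A short word on [0, i] extends to a short word on [0, i + 1], since at each step
   a coordinates can be killed.  Now let v in C be short on [0, j] with j minimal, and
   let T be a set of k(j + 1) zeros of v in [0, j].  The columns indexed by T of the
   block Toeplitz matrix of G form a square singular matrix; an element of its right
   kernel, read backwards in time, is the window of a dual word w supported on T.
   After division by D^d, where d is the delay of w, minimality of j bounds the
   number of zeros of v on [0, j - d], hence makes w short on [0, j - d].  The
   argument from the dual code to C is the same, transposed. *)

Require Import Defs.
From mathcomp Require Import all_boot all_order all_algebra zify.
From mathcomp Require Import all_classical.

Section ColumnDistance.
Set Implicit Arguments.
Unset Strict Implicit.
Unset Printing Implicit Defensive.
Import Order.TTheory GRing.Theory Num.Theory.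
Local Open Scope ring_scope.

(** * Coefficients of products of Laurent series *)

Section LaurentCoef.
Variable F : fieldType.
Implicit Types (a b : {laurent F}) (p : {poly F}).

Lemma lcoef_sum (I : Type) (r : seq I) (P : pred I) (f : I -> {laurent F}) i :
  (\sum_(x <- r | P x) f x) i = \sum_(x <- r | P x) f x i.
Proof.
by elim/big_rec2: _ => // x y z _ <-.
Qed.

Lemma laurent_of_poly_causal p : lbounded (laurent_of_poly p) 0.
Proof. by case. Qed.

Lemma lbounded0M a b : lbounded a 0 -> lbounded b 0 -> lbounded (a * b) 0.
Proof. by move=> ha hb; rewrite -[0]addr0; exact: conv_bounded. Qed.

Lemma lcoefMpoly a p (t : nat) : lbounded a 0 ->
  (a * laurent_of_poly p) t%:Z = \sum_(s < t.+1) a s%:Z * p`_(t - s).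
Proof.
move=> ha; have := convE ha (@laurent_of_poly_causal p) (ltnSn t).
rewrite addr0 add0r => E.
transitivity (conv a (laurent_of_poly p) t%:Z); first by [].
rewrite E coefM; apply: eq_bigr => s _.
rewrite !coef_poly ltn_ord !add0r ifT //; exact: leq_subr.
Qed.

Lemma lmonom_subproof (d : int) :
  exists l, lbounded (fun j : int => (j == d)%:R : F) l.
Proof. by exists d => j; case: eqP => // ->; rewrite ltxx. Qed.

(** The power D^d. Positive exponents serve to alter a word only from a given time on, negative ones
    to bring its delay back to 0. *)
Definition lmonom (d : int) : {laurent F} := Laurent (lmonom_subproof d).

Lemma lcoef_lmonomM (d : int) a i : (lmonom d * a) i = a (i - d).
Proof.
transitivity (conv (lmonom d) a i); first by [].
rewrite /conv (fsbigE [:: d]) //=.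
  by rewrite big_cons big_nil in_setT eqxx mul1r addr0.
by move=> j _ /=; rewrite inE => /negPf ->; rewrite mul0r.
Qed.

End LaurentCoef.

(** * Causal vectors and their coefficients *)

Section VectorCoef.
Variable F : finFieldType.

(** Vectors over the power series ring F[[D]]. *)
Definition causal m (v : 'rV[{laurent F}]_m) : Prop :=
  forall b, lbounded (v 0 b) 0.

Definition poly_mx_coef m1 m2 (P : 'M[{poly F}]_(m1, m2)) (i : nat) :
  'M[F]_(m1, m2) := map_mx (fun p : {poly F} => p`_i) P.

Notation lmx := (map_mx (@laurent_of_poly F)).

Lemma coef_vecD m (v w : 'rV[{laurent F}]_m) i :
  coef_vec (v + w) i = coef_vec v i + coef_vec w i.
Proof. by apply/rowP => b; rewrite !mxE. Qed.

Lemma coef_vecN m (v : 'rV[{laurent F}]_m) i :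
  coef_vec (- v) i = - coef_vec v i.
Proof. by apply/rowP => b; rewrite !mxE. Qed.

Lemma causalP m (v : 'rV[{laurent F}]_m) :
  causal v <-> forall i : int, i < 0 -> coef_vec v i = 0.
Proof.
split=> [cv i i0|cv b i i0]; first by apply/rowP => b; rewrite !mxE cv.
by have /rowP/(_ b) := cv i i0; rewrite !mxE.
Qed.

Lemma causalD m (v w : 'rV[{laurent F}]_m) : causal v -> causal w -> causal (v + w).
Proof.
by move=> /causalP cv /causalP cw; apply/causalP => i i0; rewrite coef_vecD cv ?cw ?addr0.
Qed.

Lemma causalN m (v : 'rV[{laurent F}]_m) : causal v -> causal (- v).
Proof. by move=> /causalP cv; apply/causalP => i i0; rewrite coef_vecN cv ?oppr0. Qed.

Lemma causal_mulmx m1 m2 (v : 'rV[{laurent F}]_m1) (P : 'M[{poly F}]_(m1, m2)) :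
  causal v -> causal (v *m lmx P).
Proof.
move=> cv b i i0; rewrite mxE lcoef_sum big1 // => c _.
by rewrite mxE lbounded0M //; exact: laurent_of_poly_causal.
Qed.

Lemma coef_vec_mulmx m1 m2 (v : 'rV[{laurent F}]_m1) (P : 'M[{poly F}]_(m1, m2))
    (t : nat) : causal v ->
  coef_vec (v *m lmx P) t%:Z =
  \sum_(s < t.+1) coef_vec v s%:Z *m poly_mx_coef P (t - s).
Proof.
move=> cv; apply/rowP => b; rewrite !mxE lcoef_sum summxE.
under eq_bigr => c _ do rewrite mxE (lcoefMpoly _ _ (cv c)).
rewrite exchange_big; apply: eq_bigr => s _; rewrite mxE.
by apply: eq_bigr => c _; rewrite !mxE.
Qed.

Lemma coef_vec_shift m (v : 'rV[{laurent F}]_m) d i :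
  coef_vec (lmonom F d *: v) i = coef_vec v (i - d).
Proof. by apply/rowP => b; rewrite !mxE lcoef_lmonomM. Qed.

Lemma coef_vec_const m (c : 'rV[F]_m) (i : int) :
  coef_vec (lmx (map_mx polyC c)) i = (i == 0)%:R *: c.
Proof.
by apply/rowP => b; rewrite !mxE /=; case: i => [[|i]|i] /=;
   rewrite ?coefC ?mul1r ?mul0r.
Qed.

Lemma causal_lmx m (p : 'rV[{poly F}]_m) : causal (lmx p).
Proof. by move=> b; rewrite mxE; exact: laurent_of_poly_causal. Qed.

(** * Hamming weights of vectors and windows *)

Lemma wtE m (w : 'rV[F]_m) : wt w = (\sum_b (w 0%R b != 0%R))%N.
Proof.
rewrite /wt -sum1_card big_mkcond /=; apply: eq_bigr => b _.
by rewrite unfold_in /=; case: asboolP => [->|/negP/negbTE ->].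
Qed.

Lemma wt_window0 m (j : nat) (v : 'rV[{laurent F}]_m) :
  wt (window0 j v) = (\sum_(t < j.+1) wt (coef_vec v t%:Z))%N.
Proof.
rewrite wtE (reindex _ (curry_mxvec_bij j.+1 m)) /=.
under [RHS]eq_bigr => t _ do rewrite wtE.
by rewrite pair_bigA /=; apply: eq_bigr => -[t b] _ /=; rewrite mxvecE mxE.
Qed.

Lemma eq_wt_window0 m (j : nat) (v w : 'rV[{laurent F}]_m) :
  (forall t : nat, (t <= j)%N -> coef_vec v t%:Z = coef_vec w t%:Z) ->
  wt (window0 j v) = wt (window0 j w).
Proof.
by move=> vw; rewrite !wt_window0; apply: eq_bigr => t _; rewrite vw // -ltnS.
Qed.

Lemma wt_vanish m a (w : 'rV[F]_m) (f : 'I_a -> 'I_m) (A : {set 'I_a}) :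
  injective f -> (forall i, i \in A -> w 0 (f i) = 0) -> (wt w + #|A| <= m)%N.
Proof.
move=> fI wA; rewrite -[leqRHS]card_ord -(cardsC (f @: A)) card_imset // addnC.
rewrite leq_add2l wtE -sum1_card [leqRHS]big_mkcond /=.
apply: leq_sum => b _; rewrite inE; case: imsetP => [[i iA ->]|_] /=.
  by rewrite wA // eqxx.
exact: leq_b1.
Qed.

(** * Linear algebra: information sets and kernels *)

Lemma row_free_interpolation a m (E : 'M[F]_(a, m)) : row_free E ->
  exists2 f : 'I_a -> 'I_m, injective f &
    forall y : 'rV[F]_a, exists c : 'rV_a, forall i, (c *m E) 0 (f i) = y 0 i.
Proof.
move=> Efree; have ET : row_full E^T by rewrite /row_full mxrank_tr.
(* The chosen columns of [E] form the invertible matrix [A^T], so any prescribed values there are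
   reached by inverting it. *)
exists (fullrankfun ET) => [|y]; first exact: fullrankfun_inj.
have U := fullrowsub_unit ET; set A := rowsub _ _ in U.
exists (y *m invmx A^T) => i.
have -> : (y *m invmx A^T *m E) 0 (fullrankfun ET i) =
          (y *m invmx A^T *m A^T) 0 i.
  by rewrite !mxE; apply: eq_bigr => l _; rewrite !mxE.
by rewrite mulmxKV // unitmx_tr.
Qed.

Lemma wt_coset a m (E : 'M[F]_(a, m)) (z : 'rV[F]_m) : row_free E ->
  exists c : 'rV_a, (wt (z + c *m E)%R + a <= m)%N.
Proof.
move=> /row_free_interpolation[f fI fE].
have [c cE] := fE (- \row_i z 0 (f i)); exists c.
rewrite -[X in (_ + X)%N]card_ord -cardsT; apply: (wt_vanish fI) => i _.
by rewrite mxE cE !mxE subrr.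
Qed.

Lemma wt_row_space_min a m (E : 'M[F]_(a, m)) : (0 < a)%N -> row_free E ->
  exists2 c : 'rV_a, c *m E != 0 & (wt (c *m E)%R + a <= m + 1)%N.
Proof.
case: a E => // a E _ /row_free_interpolation[f fI fE].
(* A unit vector on the information set: one entry 1 keeps the word nonzero, the others give [a - 1]
   zeros in the original [a]. *)
have [c cE] := fE (delta_mx 0 ord0); exists c.
  apply/eqP => /rowP/(_ (f ord0)); rewrite cE !mxE eqxx.
  by move/eqP; rewrite oner_eq0.
rewrite addn1 addnS ltnS.
have cA : #|[set~ ord0 : 'I_a.+1]| = a by rewrite cardsC1 card_ord.
rewrite -[X in (_ + X)%N]cA; apply: (wt_vanish fI) => i.
by rewrite !inE cE mxE eqxx /= => /negPf ->.
Qed.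

Lemma exists_subset_card (T : finType) (A : {set T}) N : (N <= #|A|)%N ->
  exists2 B : {set T}, B \subset A & #|B| = N.
Proof.
move=> NA; exists [set x in take N (enum A)].
  by apply/fintype.subsetP => x; rewrite inE => /mem_take; rewrite mem_enum.
rewrite cardsE (card_uniqP _) ?take_uniq ?enum_uniq //.
by rewrite size_takel // -cardE.
Qed.

(** Otherwise [A] has rank [q], which forces [p = q] and makes [A] row free, against [u]. *)
Lemma mx_left_right_kernel p q (A : 'M[F]_(p, q)) (u : 'rV[F]_p) :
  (p <= q)%N -> u != 0 -> u *m A = 0 -> exists2 y : 'cV[F]_q, y != 0 & A *m y = 0.
Proof.
move=> pq u0 uA.
have rA : (\rank A < q)%N.
  rewrite ltn_neqAle rank_leq_col andbT; apply/eqP => rA.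
  have pq' : p = q by apply/eqP; rewrite eqn_leq pq -rA rank_leq_row.
  have fA : row_free A by rewrite /row_free rA pq'.
  by case/eqP: u0; apply: (row_free_inj fA); rewrite uA mul0mx.
have : kermx A^T != 0.
  by rewrite -mxrank_eq0 mxrank_ker mxrank_tr subn_eq0 -ltnNge.
case/rowV0Pn => w /sub_kermxP wA w0; exists w^T.
  by apply: contraNneq w0 => /(congr1 trmx); rewrite trmxK trmx0 => ->.
by apply: trmx_inj; rewrite trmx_mul trmxK wA trmx0.
Qed.

(** The same fact for the submatrix of [M] on rows [A] and columns [B], so that Toeplitz submatrices
    can be indexed by sets of positions. *)
Lemma kernel_transfer (I J : finType) (A : {set I}) (B : {set J})
    (M : I -> J -> F) (u : I -> F) :
  (#|A| <= #|B|)%N -> (exists2 i, i \in A & u i != 0) ->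
  (forall j, j \in B -> \sum_(i in A) u i * M i j = 0) ->
  exists2 y : J -> F, (exists2 j, j \in B & y j != 0) &
    forall i, i \in A -> \sum_(j in B) M i j * y j = 0.
Proof.
move=> AB [i0 i0A ui0] uM.
pose N := \matrix_(p < #|A|, q < #|B|) M (enum_val p) (enum_val q).
have u0 : \row_(p < #|A|) u (enum_val p) != 0.
  apply: contraNneq ui0 => /rowP/(_ (enum_rank_in i0A i0)).
  by rewrite !mxE enum_rankK_in // => ->.
have [|y y0 Ny] := mx_left_right_kernel AB u0 (A := N).
  apply/rowP => q; rewrite !mxE -[RHS](uM _ (enum_valP q)) [RHS]big_enum_val.
  by apply: eq_bigr => p _; rewrite !mxE.
have /existsP[q yq] : [exists q, y q 0 != 0].
  apply: contraNT y0 => /existsPn y0; apply/eqP/colP => q; rewrite mxE.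
  by apply/eqP; rewrite -[_ == _]negbK.
pose y' j := y (enum_rank_in (enum_valP q) j) 0.
exists y'; first by exists (enum_val q); rewrite ?enum_valP // /y' enum_valK_in.
move=> i iA; have /colP/(_ (enum_rank_in iA i)) := Ny.
rewrite !mxE => {2}<-; rewrite big_enum_val; apply: eq_bigr => q' _.
by rewrite !mxE enum_rankK_in // /y' enum_valK_in.
Qed.

Lemma wt_window0S m (j : nat) (v : 'rV[{laurent F}]_m) :
  wt (window0 j.+1 v) = (wt (window0 j v) + wt (coef_vec v j.+1%:Z))%N.
Proof. by rewrite !wt_window0 big_ord_recr. Qed.

Definition window_support m (j : nat) (v : 'rV[{laurent F}]_m) :
    {set 'I_j.+1 * 'I_m} :=
  [set p : 'I_j.+1 * 'I_m | v 0 p.2 p.1%:Z != 0].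

Lemma wt_window0_card m (j : nat) (v : 'rV[{laurent F}]_m) :
  wt (window0 j v) = #|window_support j v|.
Proof.
rewrite wt_window0 -sum1_card [RHS]big_mkcond /=.
under eq_bigr => t _ do rewrite wtE.
by rewrite pair_bigA /=; apply: eq_bigr => p _; rewrite inE mxE; case: ifP.
Qed.

Definition nonzero_window m j (v : 'rV[{laurent F}]_m) : Prop :=
  exists2 t : nat, (t <= j)%N & coef_vec v t%:Z != 0.

Lemma nonzero_window_mulmx m1 m2 j (v : 'rV[{laurent F}]_m1)
    (P : 'M[{poly F}]_(m1, m2)) :
  causal v -> nonzero_window j (v *m lmx P) -> nonzero_window j v.
Proof.
move=> cv [t tj vPt]; apply: contrapT => v0; case/eqP: vPt.
rewrite coef_vec_mulmx // big1 // => s _.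
have [->|vs] := eqVneq (coef_vec v s%:Z) 0; first by rewrite mul0mx.
by case: v0; exists s => //; apply: leq_trans tj; rewrite -ltnS.
Qed.

(** * Short words and column distances *)

Variable n : nat.
Implicit Types (A B : set 'rV[{laurent F}]_n) (v w x : 'rV[{laurent F}]_n).

Lemma is_delay0P v : is_delay v 0 <-> causal v /\ coef_vec v 0 != 0.
Proof.
split=> [[v0 vlb]|[cv v0]]; split => //.
  apply/causalP => i i0; apply/eqP; apply: contraTT i0 => vi.
  by rewrite -leNgt; exact: vlb.
move=> i vi; rewrite leNgt; apply: contra vi => i0.
by apply/eqP; move/causalP: cv; exact.
Qed.

(** What a code and its dual have in common for extending words: linearity, and causal words whose
    constant terms fill a space of dimension [a]. For the code generated by [G], [E] is G(0). *)
Definition laurent_code (a : nat) A : Prop :=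
  [/\ forall v w, A v -> A w -> A (v + w),
      forall (c : {laurent F}) v, A v -> A (c *: v)
    & exists2 E : 'M[F]_(a, n), row_free E & forall c : 'rV_a,
        exists x, [/\ A x, causal x & coef_vec x 0 = c *m E]].

Definition has_short_word (a : nat) A (j : nat) : Prop :=
  exists v, [/\ A v, causal v, coef_vec v 0 != 0
    & (wt (window0 j v) <= (n - a) * j.+1)%N].

Lemma extend_word a A (j : nat) v : laurent_code a A -> A v -> causal v ->
  exists v', [/\ A v', causal v', coef_vec v' 0 = coef_vec v 0
    & (wt (window0 j.+1 v') <= wt (window0 j v) + (n - a))%N].
Proof.
move=> [AD AZ [E Efree Elead]] Av cv.
have [c cwt] := wt_coset (coef_vec v j.+1%:Z) Efree.
have [x [Ax cx x0]] := Elead c.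
(* Adding D^(j+1) x leaves times up to [j] unchanged and adds [c *m E] at time [j + 1], where [c]
   was chosen to create [a] zeros. *)
pose v' := v + lmonom F j.+1%:Z *: x; exists v'.
have v'E i : coef_vec v' i = coef_vec v i + coef_vec x (i - j.+1%:Z).
  by rewrite coef_vecD coef_vec_shift.
have v'lt (i : int) : i < j.+1%:Z -> coef_vec v' i = coef_vec v i.
  move=> ij; rewrite v'E; move/causalP: cx => ->; rewrite ?addr0 //.
  by rewrite subr_lt0.
split; [by apply: AD => //; exact: AZ| |exact: v'lt|].
  apply/causalP => i i0; rewrite v'lt; last by apply: lt_trans i0 _.
  by move/causalP: cv => ->.
rewrite wt_window0S; apply: leq_add.
  by rewrite (@eq_wt_window0 _ j v' v) // => t tj; rewrite v'lt.
by rewrite v'E subrr x0; lia.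
Qed.

Lemma has_short_wordW a A i j : laurent_code a A -> (i <= j)%N ->
  has_short_word a A i -> has_short_word a A j.
Proof.
move=> codeA /subnK <-; elim: (j - i)%N => // d IHd /IHd [v [Av cv v0 vwt]].
have [v' [Av' cv' v'0 v'wt]] := extend_word (d + i) codeA Av cv.
exists v'; split => //; first by rewrite v'0.
by apply: leq_trans v'wt _; rewrite addSn (mulnS _ (d + i).+1) addnC leq_add2l.
Qed.

(** At time 0 the constant term must stay nonzero, so only [a - 1] zeros are guaranteed, whence the
    extra 1; each later time allows [a] zeros. *)
Lemma singleton_bound a A j : (0 < a <= n)%N -> laurent_code a A ->
  exists v, [/\ A v, causal v, coef_vec v 0 != 0
    & (wt (window0 j v) <= (n - a) * j.+1 + 1)%N].
Proof.
move=> /andP[a0 an] codeA; elim: j => [|j [v [Av cv v0 vwt]]].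
  have [_ _ [E Efree Elead]] := codeA.
  have [c c0 cwt] := wt_row_space_min a0 Efree.
  have [x [Ax cx x0]] := Elead c; exists x; split; rewrite ?x0 //.
  by rewrite wt_window0 big_ord1 /= x0; lia.
have [v' [Av' cv' v'0 v'wt]] := extend_word j codeA Av cv.
exists v'; split => //; first by rewrite v'0.
by apply: leq_trans v'wt _; rewrite mulnS; lia.
Qed.

Lemma column_distance_maxP a A j : (0 < a <= n)%N -> laurent_code a A ->
  is_column_distance j A ((n - a) * j.+1 + 1)%N <-> ~ has_short_word a A j.
Proof.
move=> an codeA; split=> [[_ dmin] [v [Av cv v0 vwt]]|nshort].
  have /dmin : [set wt (window0 j v) | v in [set v | A v /\ is_delay v 0]]%classic
      (wt (window0 j v)).
    by exists v => //; split => //; exact/is_delay0P.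
  by rewrite leEnat; lia.
have lb v : A v -> is_delay v 0 -> ((n - a) * j.+1 + 1 <= wt (window0 j v))%N.
  move=> Av /is_delay0P[cv v0]; rewrite addn1 ltnNge; apply/negP => vwt.
  by apply: nshort; exists v.
split=> [|_ [v [Av dv] <-]]; last by rewrite leEnat; exact: lb.
have [v [Av cv v0 vwt]] := singleton_bound j an codeA.
have dv : is_delay v 0 by exact/is_delay0P.
by exists v => //; apply/eqP; rewrite eqn_leq vwt lb.
Qed.

(* Duality of the truncated codes, stated through shortened words: time is
   reversed because orthogonality is a convolution. *)
Definition window_duality (a : nat) A B : Prop :=
  forall j (T : {set 'I_j.+1 * 'I_n}) v, #|T| = (a * j.+1)%N ->
    A v -> causal v -> nonzero_window j v ->
    (forall p, p \in T -> v 0 p.2 p.1%:Z = 0) ->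
  exists w, [/\ B w, causal w, nonzero_window j w
    & forall p, p \notin T -> w 0 p.2 (rev_ord p.1)%:Z = 0].

(** * Transferring short words by window duality *)

Lemma card_window m j : #|{: 'I_j.+1 * 'I_m}| = (m * j.+1)%N.
Proof. by rewrite card_prod !card_ord mulnC. Qed.

Definition rev_pos m j (p : 'I_j.+1 * 'I_m) : 'I_j.+1 * 'I_m :=
  (rev_ord p.1, p.2).

Lemma rev_posK m j : involutive (@rev_pos m j).
Proof. by case=> t b; rewrite /rev_pos rev_ordK. Qed.

Lemma short_word_dual_min a A B j : (a <= n)%N ->
  (forall (c : {laurent F}) v, B v -> B (c *: v)) -> window_duality a A B ->
  has_short_word a A j -> (forall i, (i < j)%N -> ~ has_short_word a A i) ->
  exists2 i, (i <= j)%N & has_short_word (n - a) B i.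
Proof.
move=> an BZ dualAB [v [Av cv v0 vwt]] jmin.
have nE i : (n * i = (n - a) * i + a * i)%N by rewrite -mulnDl subnK.
have Sle : (a * j.+1 <= #|~: window_support j v|)%N.
  have := cardsC (window_support j v); rewrite card_window -wt_window0_card.
  by rewrite nE; lia.
have [T TS cT] := exists_subset_card Sle.
have [||w [Bw cw [t0 t0j wt0] wT]] := dualAB j T v cT Av cv; first by exists 0.
  by move=> p /(fintype.subsetP TS); rewrite !inE negbK => /eqP.
have exd : exists d : nat, coef_vec w d%:Z != 0 by exists t0.
(* [d] is the delay of [w]; after division by D^d the part of [w] up to time [j] fills the window
   [0, [e]] with [e = j - d]. *)
case: (ex_minnP exd) => d wd dmin.
have dj : (d <= j)%N by apply: leq_trans t0j; exact: dmin.
have [e ed] : exists e, (e + d = j)%N by exists (j - d)%N; exact: subnK.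
exists e; first by rewrite -ed leq_addr.
pose w' := lmonom F (- d%:Z) *: w.
have w'E i : coef_vec w' i = coef_vec w (i + d%:Z).
  by rewrite coef_vec_shift opprK.
exists w'; split; [exact: BZ| |by rewrite w'E add0r|].
  apply/causalP => i i0; rewrite w'E.
  have [/= |id0] := ltP (i + d%:Z) 0; first by move/causalP: cw; exact.
  apply/eqP; apply: contraTT i0 => wi; rewrite -leNgt.
  have := dmin `|(i + d%:Z)%R|%N; rewrite gez0_abs // => /(_ wi); lia.
rewrite subKn // wt_window0_card.
(* Time [t] of [w'] is time [t + d] of [w], whose mirror image in [0, [j]] is [j - (t + d) = e - t]:
   this is also the mirror image of [t] in [0, [e]]. *)
have w'T (t : 'I_e.+1) b : (t, b) \in window_support e w' ->
    (inord (j - (t + d)), b) \in T.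
  rewrite inE /= => w'b; apply: contraNT w'b => /wT /=.
  have tj := ltn_ord t.
  have -> : (j.+1 - (inord (j - (t + d)) : 'I_j.+1).+1)%N%:Z = t%:Z + d%:Z.
    by rewrite inordK; lia.
  move=> wtd; have /rowP/(_ b) := w'E t%:Z.
  by rewrite !mxE => ->; rewrite wtd.
(* If [d = 0], minimality of [j] says nothing about [0, [e]], but the size of [T] already gives the
   bound. *)
have [d0|d_gt0] := posnP d.
  have ej : e = j by rewrite -ed d0 addn0.
  subst e; rewrite -cT.
  rewrite -(card_preimset T (inv_inj (@rev_posK n j))).
  apply/subset_leq_card/fintype.subsetP => -[t b] /w'T; rewrite inE /rev_pos /=.
  suff -> : inord (j - (t + d)) = rev_ord t by [].
  by apply: val_inj; rewrite /= inordK; lia.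
have /jmin nshort : (e < j)%N by lia.
have vlow : ((n - a) * e.+1 < wt (window0 e v))%N.
  by rewrite ltnNge; apply/negP => vwt'; apply: nshort; exists v.
(* Reversed in [0, [e]], the support of [w'] lies among the zeros of [v], of which there are fewer
   than [a * e.+1] since [v] is not short there. *)
have : (#|window_support e w'| <= #|~: window_support e v|)%N.
  rewrite -(card_preimset (~: _) (inv_inj (@rev_posK n e))).
  apply/subset_leq_card/fintype.subsetP => -[t b] /w'T /(fintype.subsetP TS).
  rewrite !inE /rev_pos /=.
  suff -> : (inord (j - (t + d)) : 'I_j.+1) = rev_ord t :> nat by [].
  by rewrite inordK /=; lia.
have := cardsC (window_support e v); rewrite card_window nE.
by move: vlow; rewrite wt_window0_card; lia.
Qed.

Lemma short_word_dual a b A B j : (a + b)%N = n -> laurent_code b B ->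
  window_duality a A B -> has_short_word a A j -> has_short_word b B j.
Proof.
move=> abn; have an : (a <= n)%N by rewrite -abn leq_addr.
have {abn} -> : b = (n - a)%N by rewrite -abn addKn.
move=> codeB dualAB shortA.
have exj : exists i, `[< has_short_word a A i >] by exists j; exact/asboolP.
case: (ex_minnP exj) => i /asboolP shorti imin.
have ij : (i <= j)%N by apply: imin; exact/asboolP.
have [_ BZ _] := codeB.
(* The short word of [B] may live on a shorter window [0, [l]]; it is then extended to [0, [j]]. *)
have [|l li shortB] := short_word_dual_min an BZ dualAB shorti.
  by move=> l li /asboolP/imin; rewrite leqNgt li.
by apply: has_short_wordW shortB; rewrite // (leq_trans li).
Qed.

(** * Truncated block Toeplitz matrices *)

Definition toeplitz m1 m2 j (P : 'M[{poly F}]_(m1, m2))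
    (p : 'I_j.+1 * 'I_m1) (q : 'I_j.+1 * 'I_m2) : F :=
  if (p.1 <= q.1)%N then (P p.2 q.2)`_(q.1 - p.1) else 0.

(** An entry depends only on the time difference, and reversing time on both sides while swapping
    rows with columns preserves that difference. This is why duals are read backwards. *)
Lemma toeplitz_tr m1 m2 j (P : 'M[{poly F}]_(m1, m2))
    (p : 'I_j.+1 * 'I_m2) (q : 'I_j.+1 * 'I_m1) :
  toeplitz P^T (rev_pos p) q = toeplitz P (rev_pos q) p.
Proof.
case: p q => [t b] [s a]; rewrite /toeplitz /rev_pos /= mxE.
have [tj sj] := (ltn_ord t, ltn_ord s).
by do 2 case: ifP => //; rewrite ?subSS => *; try lia; congr (_`_ _); lia.
Qed.

Lemma coef_mulmx_toeplitz m1 m2 j (u : 'rV[{laurent F}]_m1)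
    (P : 'M[{poly F}]_(m1, m2)) (q : 'I_j.+1 * 'I_m2) : causal u ->
  (u *m lmx P) 0 q.2 q.1%:Z =
  \sum_(p : 'I_j.+1 * 'I_m1) u 0 p.2 p.1%:Z * toeplitz P p q.
Proof.
case: q => t b cu /=; have /rowP/(_ b) := coef_vec_mulmx P t cu.
rewrite mxE => ->; rewrite summxE.
rewrite (big_ord_widen _ (fun s =>
  (coef_vec u s%:Z *m poly_mx_coef P (t - s)) 0 b) (ltn_ord t)) big_mkcond /=.
transitivity (\sum_(s < j.+1) \sum_a u 0 a s%:Z * toeplitz P (s, a) (t, b)).
  apply: eq_bigr => s _; rewrite /toeplitz /= ltnS; case: leqP => _.
    by rewrite mxE; apply: eq_bigr => a _; rewrite !mxE.
  by rewrite big1 // => a _; rewrite mulr0.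
by rewrite pair_bigA.
Qed.

Lemma coef_mulmx_tr_toeplitz m1 m2 j (w : 'rV[{laurent F}]_m2)
    (P : 'M[{poly F}]_(m1, m2)) (q : 'I_j.+1 * 'I_m1) : causal w ->
  (w *m lmx P^T) 0 q.2 (rev_ord q.1)%:Z =
  \sum_(p : 'I_j.+1 * 'I_m2) toeplitz P q p * w 0 p.2 (rev_ord p.1)%:Z.
Proof.
move=> cw; rewrite (coef_mulmx_toeplitz P^T (rev_pos q) cw).
rewrite (reindex_inj (inv_inj (@rev_posK m2 j))); apply: eq_bigr => p _.
by rewrite toeplitz_tr rev_posK mulrC.
Qed.

Lemma exists_causal_window m j (y : 'I_j.+1 * 'I_m -> F) :
  exists2 v : 'rV[{laurent F}]_m, causal v &
    forall p : 'I_j.+1 * 'I_m, v 0 p.2 p.1%:Z = y p.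
Proof.
exists (lmx (\row_b \poly_(i < j.+1) y (inord i, b))); first exact: causal_lmx.
by case=> t b; rewrite !mxE /= coef_poly ltn_ord inord_val.
Qed.

Lemma nonzero_windowP m j (v : 'rV[{laurent F}]_m) :
  nonzero_window j v <-> exists p : 'I_j.+1 * 'I_m, v 0 p.2 p.1%:Z != 0.
Proof.
split=> [[t tj vt]|[[t b] vp]]; last first.
  exists t; first by rewrite -ltnS.
  by apply: contraNneq vp => /rowP/(_ b); rewrite !mxE => ->.
have /existsP[b vb] : [exists b, v 0 b t%:Z != 0].
  apply: contraNT vt => /existsPn v0; apply/eqP/rowP => b; rewrite !mxE.
  by apply/eqP; rewrite -[_ == _]negbK.
by exists (inord t, b); rewrite /= inordK.
Qed.

(** * The code of a basic matrix and its dual *)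

Variables (k : nat) (G : 'M[{poly F}]_(k, n)) (X : 'M[{poly F}]_(n, k)).
Hypothesis GX : G *m X = 1%:M.

Let C : set 'rV[{laurent F}]_n :=
  [set u *m lmx G | u in [set: 'rV[{laurent F}]_k]]%classic.

Let lmxGX : lmx G *m lmx X = 1%:M.
Proof. by rewrite -map_mxM GX map_mx1. Qed.

Let lmxXG_tr : lmx X^T *m lmx G^T = 1%:M.
Proof. by rewrite -map_mxM -trmx_mul GX trmx1 map_mx1. Qed.

(** The constant term of [G *m X = 1] exhibits X(0) as a right inverse of G(0). *)
Let G0_free : row_free (poly_mx_coef G 0).
Proof.
apply/row_freeP; exists (poly_mx_coef X 0); apply/matrixP => a b.
have /matrixP/(_ a b)/(congr1 (coefp 0)) := GX.
rewrite !mxE /= coef_sum => E.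
transitivity (((a == b)%:R : {poly F})`_0); last by case: eqP; rewrite ?coef1 ?coef0.
by rewrite -E; apply: eq_bigr => c _; rewrite !mxE coef0M.
Qed.

(** The message is recovered by the polynomial matrix [X], so causal codewords have causal
    messages. *)
Lemma codeE v : C v -> v = v *m lmx X *m lmx G.
Proof. by case=> u _ <-; rewrite -[u *m _ *m _]mulmxA lmxGX mulmx1. Qed.

Lemma dualE w : dual C w <-> w *m lmx G^T = 0.
Proof.
split=> [Cw|wG _ [u _ <-]]; last by rewrite trmx_mul map_trmx mulmxA wG mul0mx.
apply/rowP => a; have /Cw : C (delta_mx 0 a *m lmx G) by exists (delta_mx 0 a).
rewrite trmx_mul trmx_delta mulmxA -colE map_trmx => /colP/(_ 0).
by rewrite mxE => ->; rewrite !mxE.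
Qed.

(* Since [X^T *m G^T = 1], [1 - G^T *m X^T] is a causal projection
   onto the dual code. *)
Let proj w := w - w *m lmx G^T *m lmx X^T.

Let proj_dual w : dual C (proj w).
Proof.
by apply/dualE; rewrite mulmxBl -[w *m _ *m _ *m _]mulmxA lmxXG_tr mulmx1 subrr.
Qed.

Let proj_causal w : causal w -> causal (proj w).
Proof. by move=> cw; apply/causalD/causalN => //; do 2 apply: causal_mulmx. Qed.

(** The correction term is a causal multiple of the syndrome [w *m lmx G^T]. Hence a vector
    satisfying the parity checks only up to time [j] agrees there with a true dual word. *)
Let proj_coef w (j : nat) : causal w ->
  (forall s : nat, (s <= j)%N -> coef_vec (w *m lmx G^T) s%:Z = 0) ->
  coef_vec (proj w) j%:Z = coef_vec w j%:Z.
Proof.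
move=> cw wG; rewrite coef_vecD coef_vecN coef_vec_mulmx; last exact: causal_mulmx.
by rewrite big1 ?subr0 // => s _; rewrite wG ?mul0mx // -ltnS.
Qed.

Lemma laurent_code_generated : laurent_code k C.
Proof.
split=> [_ _ [u _ <-] [u' _ <-]|c _ [u _ <-]|].
- by exists (u + u'); rewrite ?mulmxDl.
- by exists (c *: u); rewrite ?scalemxAl.
exists (poly_mx_coef G 0) => // c; exists (lmx (map_mx polyC c) *m lmx G).
have cc := causal_lmx (map_mx polyC c).
split; [by exists (lmx (map_mx polyC c))|exact: causal_mulmx|].
by rewrite (coef_vec_mulmx G 0 cc) big_ord1 /= coef_vec_const scale1r.
Qed.

Lemma laurent_code_dual : laurent_code (n - k) (dual C).
Proof.
split=> [v w /dualE vG /dualE wG|c v /dualE vG|].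
- by apply/dualE; rewrite mulmxDl vG wG addr0.
- by apply/dualE; rewrite -scalemxAl vG scaler0.
have rE : \rank (kermx (poly_mx_coef G 0)^T) = (n - k)%N.
  by rewrite mxrank_ker mxrank_tr (eqP G0_free).
have [E Efree EG] : exists2 E : 'M[F]_(n - k, n),
    row_free E & E *m (poly_mx_coef G 0)^T = 0.
  rewrite -rE; exists (row_base (kermx (poly_mx_coef G 0)^T)).
    exact: row_base_free.
  by apply/sub_kermxP; rewrite eq_row_base.
(* The constant vector [c *m E] satisfies the parity checks at time 0, so projecting it to the dual
   keeps its constant term. *)
exists E => // c; pose w := lmx (map_mx polyC (c *m E)).
have cw : causal w by exact: causal_lmx.
exists (proj w); split; [exact: proj_dual|exact: proj_causal|].
rewrite (proj_coef cw) ?coef_vec_const ?scale1r // => s.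
rewrite leqn0 => /eqP ->; rewrite (coef_vec_mulmx _ 0 cw) big_ord1 /=.
rewrite coef_vec_const scale1r /= /poly_mx_coef -map_trmx -mulmxA.
by rewrite [E *m _]EG mulmx0.
Qed.

Lemma window_duality_code : window_duality k C (dual C).
Proof.
move=> j T v cT Cv cv vnz vT; pose u := v *m lmx X.
have cu : causal u by exact: causal_mulmx.
have vE := codeE Cv; rewrite -/u in vE.
have unz : nonzero_window j u by apply: (nonzero_window_mulmx (P := G)); rewrite -?vE.
have /nonzero_windowP[p up] := unz.
(* The columns of the Toeplitz matrix in [T] form a square matrix, and the message window [u] is in
   its left kernel. *)
have [|||y [q qT yq] yM] := @kernel_transfer _ _ [set: 'I_j.+1 * 'I_k] T
    (toeplitz G) (fun p : 'I_j.+1 * _ => u 0 p.2 p.1%:Z).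
- by rewrite cardsT card_window cT.
- by exists p.
- move=> q qT; rewrite -[RHS](vT q qT) vE (coef_mulmx_toeplitz _ _ cu).
  by apply: eq_bigl => p'; rewrite inE.
have [w cw wy] := exists_causal_window
  (fun p : 'I_j.+1 * _ => if rev_pos p \in T then y (rev_pos p) else 0).
have wrev r : w 0 r.2 (rev_ord r.1)%:Z = if r \in T then y r else 0.
  by have := wy (rev_pos r); rewrite rev_posK.
have wG s : (s <= j)%N -> coef_vec (w *m lmx G^T) s%:Z = 0.
  move=> sj; apply/rowP => a; rewrite mxE [RHS]mxE.
  (* Row [rev_ord s] of the kernel equation for [y] is the syndrome of [w] at time [s]. *)
  have -> : s = rev_ord (rev_ord (inord s : 'I_j.+1)) by rewrite rev_ordK inordK.
  rewrite (coef_mulmx_tr_toeplitz G (rev_ord (inord s), a) cw).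
  rewrite -[RHS](yM (rev_ord (inord s), a)) ?inE // [RHS]big_mkcond.
  by apply: eq_bigr => r _; rewrite wrev; case: ifP => // _; rewrite mulr0.
have wproj t : (t <= j)%N -> coef_vec (proj w) t%:Z = coef_vec w t%:Z.
  by move=> tj; apply: proj_coef => // s st; apply/wG/(leq_trans st).
exists (proj w); split; [exact: proj_dual|exact: proj_causal| |].
  have [|t tj wt] := (nonzero_windowP j w).2 _.
    by exists (rev_pos q); rewrite wy rev_posK qT.
  by exists t; rewrite ?wproj.
move=> r rT; have /rowP/(_ r.2) := wproj (rev_ord r.1) (ltn_ord (rev_ord r.1)).
by rewrite !mxE => ->; rewrite wrev (negPf rT).
Qed.

Lemma window_duality_dual : (k <= n)%N -> window_duality (n - k) (dual C) C.
Proof.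
move=> kn j T w cT /dualE wG cw /nonzero_windowP[p wp] wT.
(* The positions, reversed in time, where [w] may be nonzero; there are as many as message
   positions, so the system is again square. *)
pose A := rev_pos (j := j) @^-1: (~: T).
have cA : #|A| = (k * j.+1)%N.
  rewrite card_preimset; last exact: (inv_inj (@rev_posK n j)).
  by rewrite cardsCs finset.setCK cT card_window -mulnBl subKn.
have [|||y [q _ yq] yM] := @kernel_transfer _ _ A [set: 'I_j.+1 * 'I_k]
    (fun p q => toeplitz G q p) (fun p : 'I_j.+1 * _ => w 0 p.2 (rev_ord p.1)%:Z).
- by rewrite cardsT card_window cA.
- exists (rev_pos p); last by rewrite -[p]rev_posK in wp.
  by rewrite !inE rev_posK; apply: contraNN wp => /wT ->.
- move=> q _; have := coef_mulmx_tr_toeplitz G q cw.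
  rewrite wG mxE => /esym; rewrite (bigID (mem A)) /= [X in _ + X]big1 ?addr0.
    by move=> wG0; rewrite -[RHS]wG0; apply: eq_bigr => r _; rewrite mulrC.
  move=> r; rewrite !inE negbK => /wT /= ->; exact: mulr0.
have [u cu uy] := exists_causal_window y.
have unz : nonzero_window j u by apply/nonzero_windowP; exists q; rewrite uy.
exists (u *m lmx G); split; [by exists u|exact: causal_mulmx| |].
  (* Were the codeword zero on the window, its message, obtained by multiplying with [X], would be
     zero there too. *)
  apply: (nonzero_window_mulmx (P := X)); first exact: causal_mulmx.
  by rewrite -mulmxA lmxGX mulmx1.
move=> r rT; rewrite (coef_mulmx_toeplitz G (rev_pos r) cu).
rewrite -[RHS](yM (rev_pos r)); last by rewrite !inE rev_posK.
by apply: eq_big => [r'|r' _]; rewrite ?inE // uy mulrC.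
Qed.

End VectorCoef.

Lemma strongly_MDSP (F : finFieldType) n k delta (A : set 'rV[{laurent F}]_n) :
  (0 < k < n)%N -> (k %| delta)%N -> (n - k %| delta)%N ->
  laurent_code k A ->
  strongly_MDS k delta A <->
  ~ has_short_word k A (delta %/ k + delta %/ (n - k)).
Proof.
move=> /andP[k0 kn] kd nkd codeA.
rewrite /strongly_MDS /ceil_divn nkd addn0.
rewrite -column_distance_maxP //; last by rewrite k0 ltnW.
(* Writing [delta] as [(n - k) * (delta %/ (n - k))] turns the prescribed distance into the largest
   possible one for this window. *)
suff -> : ((n - k) * (delta %/ k + 1) + delta + 1 =
  (n - k) * (delta %/ k + delta %/ (n - k)).+1 + 1)%N by [].
by rewrite [(_ %/ k + 1)%N]addn1 -addSn mulnDr [(_ * (_ %/ (n - k)))%N]mulnC divnK.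
Qed.

End ColumnDistance.

Theorem corollary5p5 (F : finFieldType) (n k delta : nat)
    (C : set 'rV[{laurent F}]_n) :
  is_code k delta C -> k %| delta -> n - k %| delta ->
  strongly_MDS k delta C <-> strongly_MDS (n - k) delta (dual C).
Proof.
case=> kn [G [[[_ CG] _] [X GX] _]] kd nkd; rewrite {}CG.
have [k0 k_lt_n] := andP kn; have k_le_n := ltnW k_lt_n.
have codeC := laurent_code_generated GX; have codeD := laurent_code_dual GX.
rewrite (strongly_MDSP kn kd nkd codeC) strongly_MDSP //; first last.
- by rewrite subKn.
- by rewrite subn_gt0 k_lt_n ltn_subrL k0 (ltn_trans k0).
(* Exchanging [k] and [n - k] swaps the two summands of the window length, so both codes are
   compared on the same window. *)
rewrite subKn // [(_ %/ (n - k) + _)%N]addnC.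
split; apply: contra_not.
  apply: short_word_dual codeC (window_duality_dual GX k_le_n).
  exact: subnK.
apply: short_word_dual codeD (window_duality_code GX).
exact: subnKC.
Qed.
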